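(* Let $\mathcal{A}$ be a unital $C^*$-algebra and $\mathcal{H}$ a complex Hilbert space with $\dim(\mathcal{H})<\infty$. Then the set of $C^*$-extreme points of $\mathrm{CCP}(\mathcal{A},\mathscr{B}(\mathcal{H}))$ equals the union, over all (orthogonal) projections $P=P^2=P^*\in\mathscr{B}(\mathcal{H})$, of the sets of $P$-$C^*$-extreme points of $\mathrm{CP}^{(P)}(\mathcal{A},\mathscr{B}(\mathcal{H}))$.
   Context: $\mathscr{B}(\mathcal{H})$ is the algebra of bounded linear operators on $\mathcal{H}$; $1$ is the unit of $\mathcal{A}$, $I$ the identity operator. ''CP'' means completely positive (linear). For $T\in\mathscr{B}(\mathcal{H})$, $\mathrm{Ad}_T(X):=T^*XT$. $\mathrm{CCP}(\mathcal{A},\mathscr{B}(\mathcal{H}))$ is the set of all contractive CP maps $\Phi:\mathcal{A}\to\mathscr{B}(\mathcal{H})$ (equivalently CP maps with $\Phi(1)\leq I$). A map $\Phi\in\mathrm{CCP}(\mathcal{A},\mathscr{B}(\mathcal{H}))$ is a $C^*$-extreme point of it if whenever $\Phi=\sum_{j=1}^n\mathrm{Ad}_{T_j}\circ\Phi_j$ with $\Phi_j\in\mathrm{CCP}(\mathcal{A},\mathscr{B}(\mathcal{H}))$ and $T_j\in\mathscr{B}(\mathcal{H})$ invertible with $\sum_{j=1}^nT_j^*T_j=I$, there exist unitaries $U_j\in\mathscr{B}(\mathcal{H})$ with $\Phi_j=\mathrm{Ad}_{U_j}\circ\Phi$ for all $j$. For a positive operator $P$, $\mathrm{CP}^{(P)}(\mathcal{A},\mathscr{B}(\mathcal{H}))$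 is the set of all CP maps $\Phi:\mathcal{A}\to\mathscr{B}(\mathcal{H})$ with $\Phi(1)=P$. A map $\Phi\in\mathrm{CP}^{(P)}(\mathcal{A},\mathscr{B}(\mathcal{H}))$ is a $P$-$C^*$-extreme point of this set if whenever $\Phi=\sum_{j=1}^n\mathrm{Ad}_{T_j}\circ\Phi_j$ with $n\ge 1$, $\Phi_j\in\mathrm{CP}^{(P)}(\mathcal{A},\mathscr{B}(\mathcal{H}))$ and $T_j\in\mathscr{B}(\mathcal{H})$ invertible with $\sum_{j=1}^nT_j^*PT_j=P$, there exist invertible $S_j\in\mathscr{B}(\mathcal{H})$ such that $\Phi_j=\mathrm{Ad}_{S_j}\circ\Phi$ for all $1\leq j\leq n$. *)

(* Defs.v *)
From HB Require Import structures.
From mathcomp Require Import all_boot all_order all_algebra.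
From mathcomp Require Import complex.
From mathcomp Require Import all_classical all_reals all_analysis.

Set Implicit Arguments.
Unset Strict Implicit.
Unset Printing Implicit Defensive.

Import Order.TTheory GRing.Theory Num.Theory.
Import numFieldNormedType.Exports.

Local Open Scope classical_set_scope.
Local Open Scope ring_scope.

(* The norm is a field of the mixin because Hierarchy Builder cannot join
   [algType] with [normedModType]: their join is already [numDomainType]. *)
HB.mixin Record isCStarAlgebra (R : realType) A of GRing.Algebra R[i] A := {
  star : A -> A;
  cnorm : A -> R;
  starK : involutive star;
  starD : {morph star : a b / a + b};
  starZ : forall (c : R[i]) a, star (c *: a) = c^* *: star a;
  starM : forall a b, star (a * b) = star b * star a;
  cnorm0_eq0 : forall a, cnorm a = 0 -> a = 0;
  ler_cnormD : forall a b, cnorm (a + b) <= cnorm a + cnorm b;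
  cnormZ : forall (c : R[i]) a, cnorm (c *: a) = complex.Re `|c| * cnorm a;
  ler_cnormM : forall a b, cnorm (a * b) <= cnorm a * cnorm b;
  cnorm_star_mul : forall a, cnorm (star a * a) = cnorm a ^+ 2;
  cnorm_complete : forall a_ : nat -> A,
    (forall e : R, 0 < e -> \forall m & n \near \oo, cnorm (a_ m - a_ n) < e) ->
    exists a : A, (cnorm (a_ n - a) @[n --> \oo] --> (0 : R))%classic;
}.

(* A unital complex C*-algebra; as [algType] extends [nzRingType], 1 != 0. *)
#[short(type="cstarAlgType")]
HB.structure Definition CStarAlgebra (R : realType) :=
  {A of isCStarAlgebra R A & GRing.Algebra R[i] A}.

(* [H] with [dot] is a finite-dimensional complex Hilbert space ([dot] is
   linear in its first argument), so that B(H) is the whole of ['End(H)]. *)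
Section Operators.
Variables (R : realType) (H : vectType R[i]) (dot : {dot H for Num.conj}).
Implicit Types (T S P U : 'End(H)) (u v : H).

Local Notation "''[' u , v ]" := (dot u%R v%R) : ring_scope.

Definition hnorm u : R := Num.sqrt (complex.Re '[u, u]).

Definition is_adjoint T S := forall u v, '[T u, v] = '[u, S v].

Definition adj T : 'End(H) := xget 0 [set S | is_adjoint T S].

Lemma dot_inj v w : (forall u, '[u, v] = '[u, w]) -> v = w.
Proof.
move=> e; apply/eqP; rewrite -subr_eq0; apply/negPn/negP => /(@neq0_dnorm_gt0 _ _ _ dot).
by rewrite linearBr /= e subrr ltxx.
Qed.

Lemma adjoint_exists T : exists S, is_adjoint T S.
Proof.
pose n := \dim (fullv : {vspace H}); pose e := vbasis (fullv : {vspace H}).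
have ext v w : (forall j : 'I_n, '[e`_j, v] = '[e`_j, w]) ->
    forall u, '[u, v] = '[u, w].
  move=> vw u; have := memvf u; rewrite -(span_basis (vbasisP fullv)).
  move=> /coord_span ->; rewrite !linear_sumlz; apply: eq_bigr => j _.
  by rewrite !linearZl_LR /= vw.
pose f v : 'rV[R[i]]_n := \row_j '[v, e`_j].
have lf : linear f.
  by move=> c v w; apply/rowP => j; rewrite !mxE linearDl linearZl_LR.
pose fL : {linear H -> 'rV[R[i]]_n} :=
  HB.pack f (GRing.isLinear.Build _ _ _ _ f lf).
pose F := linfun fL.
have FE v : F v = f v by rewrite lfunE.
have kerF : lker F == 0%VS.
  apply/lker0P => v w; rewrite !FE => /rowP vw; apply/dot_inj/ext => j.
  rewrite hermC [RHS]hermC; do 2!congr (_ _); by have := vw j; rewrite !mxE.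
have imF : limg F = fullv.
  apply/eqP; rewrite eqEdim subvf /= limg_dim_eq ?(eqP kerF) ?capv0 //.
  by rewrite dimvf /dim /= mul1n.
pose g v : 'rV[R[i]]_n := \row_j '[v, T e`_j].
have lg : linear g.
  by move=> c v w; apply/rowP => j; rewrite !mxE linearDl linearZl_LR.
pose gL : {linear H -> 'rV[R[i]]_n} :=
  HB.pack g (GRing.isLinear.Build _ _ _ _ g lg).
exists (F^-1 \o linfun gL)%VF => u v.
set w := (F^-1 \o linfun gL)%VF v.
have Fw : f w = g v.
  by rewrite -FE /w comp_lfunE limg_lfunVK ?imF ?memvf // lfunE.
have := memvf u; rewrite -(span_basis (vbasisP fullv)) => /coord_span ->.
rewrite linear_sum !linear_sumlz; apply: eq_bigr => j _.
rewrite linearZ /= !linearZl_LR /=; congr (_ * _).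
by rewrite hermC [RHS]hermC; do 2!congr (_ _); have /rowP/(_ j) := Fw; rewrite !mxE.
Qed.

Lemma adjP T : is_adjoint T (adj T).
Proof. exact: xgetPex (adjoint_exists T). Qed.

Lemma adj_unique T S : is_adjoint T S -> S = adj T.
Proof.
by move=> TS; apply/lfunP => v; apply: dot_inj => u; rewrite -TS (adjP T).
Qed.

Definition projection P := (P \o P)%VF = P /\ adj P = P.

Definition invertible T := exists S, (S \o T)%VF = \1%VF /\ (T \o S)%VF = \1%VF.

Definition unitary U := (adj U \o U)%VF = \1%VF /\ (U \o adj U)%VF = \1%VF.

Definition Ad T (X : 'End(H)) : 'End(H) := (adj T \o X \o T)%VF.

End Operators.

Section Maps.
Variables (R : realType) (A : cstarAlgType R).
Variables (H : vectType R[i]) (dot : {dot H for Num.conj}).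
Implicit Types (Phi : A -> 'End(H)) (P : 'End(H)).

Definition mxstar n (Y : 'M[A]_n) : 'M[A]_n := \matrix_(i, j) star (Y j i).

Definition positive_mx n (X : 'M[A]_n) := exists Y, X = mxstar Y *m Y.

(* [X : 'M['End(H)]_n] acts on the orthogonal sum of n copies of [H]. *)
Definition positive_opmx n (X : 'M['End(H)]_n) :=
  forall h : 'I_n -> H, 0 <= \sum_i \sum_j dot (X i j (h j)) (h i).

Definition completely_positive Phi :=
  linear Phi /\
  forall n (X : 'M[A]_n), positive_mx X -> positive_opmx (map_mx Phi X).

(* The operator norm of [Phi a] is at most the norm of [a]. *)
Definition contractive Phi :=
  forall a u, hnorm dot (Phi a u) <= cnorm a * hnorm dot u.

Definition CCP : set (A -> 'End(H)) :=
  [set Phi | completely_positive Phi /\ contractive Phi].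

Definition cstar_extreme_CCP : set (A -> 'End(H)) :=
  [set Phi | CCP Phi /\
    forall n (Phis : 'I_n -> A -> 'End(H)) (T : 'I_n -> 'End(H)),
      (0 < n)%N ->
      (forall j, CCP (Phis j)) ->
      (forall j, invertible (T j)) ->
      \sum_j (adj dot (T j) \o T j)%VF = \1%VF ->
      (forall a, Phi a = \sum_j Ad dot (T j) (Phis j a)) ->
      exists U : 'I_n -> 'End(H),
        forall j, unitary dot (U j) /\
          (forall a, Phis j a = Ad dot (U j) (Phi a))].

Definition CP_at P : set (A -> 'End(H)) :=
  [set Phi | completely_positive Phi /\ Phi 1 = P].

Definition cstar_extreme_CP_at P : set (A -> 'End(H)) :=
  [set Phi | CP_at P Phi /\
    forall n (Phis : 'I_n -> A -> 'End(H)) (T : 'I_n -> 'End(H)),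
      (0 < n)%N ->
      (forall j, CP_at P (Phis j)) ->
      (forall j, invertible (T j)) ->
      \sum_j (adj dot (T j) \o P \o T j)%VF = P ->
      (forall a, Phi a = \sum_j Ad dot (T j) (Phis j a)) ->
      exists S : 'I_n -> 'End(H),
        forall j, invertible (S j) /\
          (forall a, Phis j a = Ad dot (S j) (Phi a))].

End Maps.

Arguments CCP {R} A {H} dot _.
Arguments cstar_extreme_CCP {R} A {H} dot _.
Arguments CP_at {R} A {H} dot P _.
Arguments cstar_extreme_CP_at {R} A {H} dot P _.

(* Main.v *)
(* A completely positive map satisfies Phi(a)^* Phi(a) <= |a|^2 Phi(1) once Phi(1) <= I, so
   contractivity only concerns Phi(1); this uses that |a|^2 - a^* a + e has a square root.

   If Phi is C*-extreme in CCP, then P = Phi(1) is a projection.  Otherwise pick g with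
   <(P - P^2) g, g> > 0, put f = (1 - P) g and s = <f, g> > <f, f>, and split Phi as
   sum_j Ad_{T_j} (Ad_{T_j^-1} (Phi / 2)) with 2 T_j^* T_j = 1 -+ |f><f| / s >= P.  Extremality
   makes Ad_{S_1^-1} P, where S_1 = sqrt 2 T_1, unitarily equivalent to P, whereas its eigenspace
   for 1 has the dimension of ker (S_1^* S_1 - P), which contains both ker (1 - P) and g.

   When P is a projection, a decomposition in CP^(P) becomes one in CCP by replacing T_j with
   P T_j + n^(-1/2) (1 - P).  Conversely, in a decomposition in CCP the operators Phi_j(1) are
   forced to satisfy Phi_j(1) T_j = T_j P, so they are projections of the same rank as P, and
   conjugating by unitaries that carry P to Phi_j(1) gives a decomposition in CP^(P).  The
   resulting invertible S_j satisfy S_j^* P S_j = P, so P S_j + (1 - P) is unitary and acts on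
   Phi as S_j does. *)
From HB Require Import structures.
Require Import Defs.
From mathcomp Require Import all_boot all_order all_algebra.
From mathcomp Require Import complex.
From mathcomp Require Import all_classical all_reals all_analysis.
From mathcomp Require Import ring lra.

Set Implicit Arguments.
Unset Strict Implicit.
Unset Printing Implicit Defensive.

Import Order.TTheory GRing.Theory Num.Theory.
Import numFieldNormedType.Exports.

Local Open Scope classical_set_scope.
Local Open Scope ring_scope.
Local Open Scope complex_scope.

(** * Square roots in a C*-algebra by fixed-point iteration *)

Section CStarSquareRoot.
Variables (R : realType) (A : cstarAlgType R).
Implicit Types a b x y : A.

Lemma cnorm0 : cnorm (0 : A) = 0.
Proof. by rewrite -[0 in LHS](scale0r (0 : A)) cnormZ normr0 mul0r. Qed.

Lemma cnormN a : cnorm (- a) = cnorm a.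
Proof. by rewrite -scaleN1r cnormZ normrN normr1 mul1r. Qed.

Lemma cnorm_ge0 a : 0 <= cnorm a.
Proof.
have := ler_cnormD a (- a); rewrite subrr cnorm0 cnormN => h; lra.
Qed.

Lemma cnorm_distC a b : cnorm (a - b) = cnorm (b - a).
Proof. by rewrite -cnormN opprB. Qed.

Lemma cnormZr (c : R) a : 0 <= c -> cnorm (c%:C *: a) = c * cnorm a.
Proof. by move=> c0; rewrite cnormZ ger0_norm // ler0c. Qed.

Lemma star1 : star (1 : A) = 1.
Proof. by rewrite -[RHS](starK 1) -[in RHS](mulr1 (star 1)) starM starK mulr1. Qed.

Lemma cnorm1 : cnorm (1 : A) = 1.
Proof.
have n0 : cnorm (1 : A) != 0.
  by apply/eqP => /cnorm0_eq0/eqP; rewrite oner_eq0.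
have := cnorm_star_mul (1 : A); rewrite star1 mulr1 expr2 => e.
by apply: (mulIf n0); rewrite -e mul1r.
Qed.

(** The C*-identity gives |b|^2 <= |b^*| |b|, hence |b| <= |b^*|; using this at [star a] as well
    gives equality. *)
Lemma cnorm_star a : cnorm (star a) = cnorm a.
Proof.
have le b : cnorm b <= cnorm (star b).
  have [b0|nb0] := eqVneq (cnorm b) 0; first by rewrite b0 cnorm_ge0.
  have b0 : 0 < cnorm b by rewrite lt_neqAle eq_sym nb0 cnorm_ge0.
  by rewrite -(ler_pM2r b0) -expr2 -cnorm_star_mul ler_cnormM.
by apply/eqP; rewrite eq_le le andbT -{2}(starK a) le.
Qed.

Lemma starB a b : star (a - b) = star a - star b.
Proof.
rewrite starD; congr (_ + _).
by rewrite -scaleN1r starZ rmorphN rmorph1 scaleN1r.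
Qed.

Lemma star0 : star (0 : A) = 0.
Proof. by rewrite -[in LHS](subrr (1 : A)) starB subrr. Qed.

Section Iteration.
Variables (x : A) (r : R).
Hypotheses (sx : star x = x) (xr : cnorm x <= r) (r1 : r < 1).

(* The limit [y] satisfies [2 y = x + y ^ 2], that is, [(1 - y) ^ 2 = 1 - x]. *)
Let step y : A := (2^-1 : R)%:C *: (x + y * y).
Let y_ n : A := iter n step 0.

Let r_ge0 : 0 <= r. Proof. exact: le_trans (cnorm_ge0 x) xr. Qed.

Let half_ge0 : 0 <= 2^-1 :> R. Proof. by rewrite invr_ge0. Qed.

(** The ball of radius [r] is stable under [step], because (r + r^2) / 2 <= r. *)
Let y_le n : cnorm (y_ n) <= r.
Proof.
elim: n => [|n IH]; first by rewrite cnorm0.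
rewrite /y_ iterS -/(y_ n) /step cnormZr //.
have h1 := ler_cnormD x (y_ n * y_ n); have h2 := ler_cnormM (y_ n) (y_ n).
have h3 : cnorm (y_ n) * cnorm (y_ n) <= r * r by rewrite ler_pM // cnorm_ge0.
have h4 : r * r <= r by rewrite ler_piMr // ltW.
rewrite ler_pdivrMl //; have := xr; lra.
Qed.

Let sqr_dist a b s : cnorm a <= s -> cnorm b <= s ->
  cnorm (a * a - b * b) <= 2 * s * cnorm (a - b).
Proof.
move=> as_ bs.
have -> : a * a - b * b = a * (a - b) + (a - b) * b.
  by rewrite mulrBr mulrBl addrA subrK.
apply: le_trans (ler_cnormD _ _) _.
have h1 := ler_cnormM a (a - b); have h2 := ler_cnormM (a - b) b.
have := cnorm_ge0 (a - b); nra.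
Qed.

(** By [sqr_dist], [step] contracts distances by the factor [r] on the ball of radius [r]; the base
    case uses [y_ 0] = 0 and r < 1. *)
Let y_dist m n : cnorm (y_ (n + m) - y_ n) <= r ^+ n.
Proof.
elim: n => [|n IH].
  rewrite add0n subr0 expr0; exact: le_trans (y_le _) (ltW r1).
rewrite addSn /y_ !iterS -/(y_ n) -/(y_ (n + m)) /step -scalerBr cnormZr //.
rewrite opprD addrACA subrr add0r exprS.
have h := sqr_dist (y_le (n + m)) (y_le n).
have h2 := ler_wpM2l r_ge0 IH.
rewrite ler_pdivrMl //; lra.
Qed.

Let y_cauchy e : 0 < e -> exists N, forall m n, (N <= m)%N -> (N <= n)%N ->
  cnorm (y_ m - y_ n) < e.
Proof.
move=> e0.
have : r ^+ n @[n --> \oo] --> (0 : R) by apply: cvg_expr; rewrite ger0_norm.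
move=> /cvgrPdist_lt /(_ e e0) [N _ hN]; exists N.
have lt p : (N <= p)%N -> r ^+ p < e.
  move=> /hN; rewrite /= sub0r normrN ger0_norm //; exact: exprn_ge0.
have main m n : (N <= m)%N -> (m <= n)%N -> cnorm (y_ n - y_ m) < e.
  move=> Nm mn; rewrite -(subnKC mn); exact: le_lt_trans (y_dist _ _) (lt _ Nm).
move=> m n Nm Nn; have [mn|/ltnW nm] := leqP m n; last exact: main.
by rewrite cnorm_distC; exact: main.
Qed.

Lemma cstar_sqrt : exists y, star y * y = 1 - x.
Proof.
have [|y yl] := @cnorm_complete _ A y_.
  move=> e /y_cauchy [N hN].
  exists ([set n | (N <= n)%N], [set n | (N <= n)%N]) => /=.
    by split; exists N.
  by move=> [m n] /= [Nm Nn]; exact: hN.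
have yl' e : 0 < e -> exists N, forall n, (N <= n)%N -> cnorm (y_ n - y) < e.
  move=> e0; have /cvgrPdist_lt /(_ e e0) [N _ hN] := yl.
  exists N => n /hN; rewrite /= sub0r normrN ger0_norm //; exact: cnorm_ge0.
(* Both properties of the limit, [sy] and [yE], come from bounding a norm by K e for every e > 0. *)
have eq0 a K : (forall e, 0 < e -> cnorm a <= K * e) -> a = 0.
  move=> h; apply: cnorm0_eq0; apply/eqP; rewrite eq_le cnorm_ge0 andbT.
  have K0 : 0 <= K by rewrite -[K]mulr1; apply: le_trans (h 1 ltr01); exact: cnorm_ge0.
  apply/ler_addgt0Pl => e e0; rewrite addr0.
  have K1 : 0 < K + 1 by lra.
  apply: le_trans (h (e / (K + 1)) (divr_gt0 e0 K1)) _.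
  rewrite mulrCA ger_pMr // ler_pdivrMr //; lra.
have sy_ n : star (y_ n) = y_ n.
  elim: n => [|n IH]; first exact: star0.
  rewrite /y_ iterS -/(y_ n) /step starZ starD starM IH sx; congr (_ *: _).
  by apply: conj_Creal; rewrite complex_real.
have sy : star y = y.
  apply/eqP; rewrite -subr_eq0; apply/eqP; apply: (eq0 _ 2) => e /yl' [N hN].
  have {}hN := hN N (leqnn N).
  have -> : star y - y = star (y - y_ N) + (y_ N - y).
    by rewrite starB sy_ addrA subrK.
  apply: le_trans (ler_cnormD _ _) _; rewrite cnorm_star cnorm_distC; lra.
have yE : (2 : R)%:C *: y = x + y * y.
  apply/eqP; rewrite -subr_eq0; apply/eqP.
  pose s := r + cnorm y.
  apply: (eq0 _ (2 + 2 * s)) => e /yl' [N hN].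
  have h1 := hN N (leqnn N); have h2 := hN N.+1 (leqnSn N).
  have E : (2 : R)%:C *: y_ N.+1 = x + y_ N * y_ N.
    rewrite /y_ iterS -/(y_ N) /step scalerA.
    by rewrite -rmorphM /= divff ?pnatr_eq0 // scale1r.
  have -> : (2 : R)%:C *: y - (x + y * y)
      = (2 : R)%:C *: (y - y_ N.+1) + (y_ N * y_ N - y * y).
    by rewrite scalerBr E !opprD !addrA subrK.
  apply: le_trans (ler_cnormD _ _) _.
  rewrite cnormZr // cnorm_distC.
  have ys : cnorm y <= s by rewrite /s; have := r_ge0; lra.
  have yNs : cnorm (y_ N) <= s by rewrite /s; have := y_le N; have := cnorm_ge0 y; lra.
  have h3 := sqr_dist yNs ys; have s0 := le_trans (cnorm_ge0 _) ys; nra.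
exists (1 - y); rewrite starB star1 sy mulrBr mulr1 mulrBl mul1r.
have e2 : y + y = x + y * y by rewrite -yE rmorph_nat scaler_nat mulr2n.
have -> : x = y + y - y * y by rewrite e2 addrK.
by rewrite !opprB opprD !addrA; congr (_ + _); rewrite addrAC.
Qed.

End Iteration.
End CStarSquareRoot.

(** * Adjoints, invertible operators, unitaries and projections *)

Section OperatorAlgebra.
Variables (R : realType) (H : vectType R[i]) (dot : {dot H for Num.conj}).
Implicit Types (T S P U X : 'End(H)) (u v : H).

Local Notation "''[' u , v ]" := (dot u%R v%R) : ring_scope.
Local Notation adj := (adj dot).

Lemma dotC u v : '[u, v] = ('[v, u])^*%R.
Proof. by rewrite hermC expr0 mul1r. Qed.

Lemma dotDl u v w : '[u + v, w] = '[u, w] + '[v, w]. Proof. exact: linearDl. Qed.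
Lemma dotDr u v w : '[w, u + v] = '[w, u] + '[w, v]. Proof. exact: linearDr. Qed.
Lemma dotBl u v w : '[u - v, w] = '[u, w] - '[v, w]. Proof. exact: linearBl. Qed.
Lemma dotBr u v w : '[w, u - v] = '[w, u] - '[w, v]. Proof. exact: linearBr. Qed.
Lemma dotNl u w : '[- u, w] = - '[u, w]. Proof. exact: linearNl. Qed.
Lemma dotNr u w : '[w, - u] = - '[w, u]. Proof. exact: linearNr. Qed.
Lemma dotZl c u w : '[c *: u, w] = c * '[u, w]. Proof. exact: linearZl_LR. Qed.
Lemma dotZr c u w : '[w, c *: u] = c^*%R * '[w, u]. Proof. exact: linearZr_LR. Qed.
Lemma dot0l w : '[0, w] = 0. Proof. exact: linear0l. Qed.
Lemma dot0r w : '[w, 0] = 0. Proof. exact: linear0r. Qed.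

Lemma dot_ge0 u : 0 <= '[u, u]. Proof. exact: dnorm_ge0. Qed.

Lemma dot_hnorm u : '[u, u] = (hnorm dot u ^+ 2)%:C.
Proof.
have u0 := dot_ge0 u.
by rewrite sqr_sqrtr ?RRe_real ?ger0_real //; move: u0; rewrite lecE => /andP[].
Qed.

Lemma dot_eq0 u : '[u, u] = 0 -> u = 0.
Proof. by move/eqP; rewrite dnorm_eq0 => /eqP. Qed.

Lemma dot_injl v w : (forall u, '[v, u] = '[w, u]) -> v = w.
Proof. by move=> e; apply: (@dot_inj _ _ dot) => u; rewrite dotC e -dotC. Qed.

Lemma adjE T u v : '[T u, v] = '[u, adj T v]. Proof. exact: adjP. Qed.

Lemma adjEl T u v : '[adj T u, v] = '[u, T v].
Proof. by rewrite dotC -adjE -dotC. Qed.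

Lemma adjI T S : (forall u v, '[T u, v] = '[u, S v]) -> adj T = S.
Proof. by move=> e; rewrite -(adj_unique (T := T) (S := S)). Qed.

Lemma adjK T : adj (adj T) = T.
Proof. by apply: adjI => u v; rewrite adjEl. Qed.

Lemma adjM T S : adj (T \o S)%VF = (adj S \o adj T)%VF.
Proof. by apply: adjI => u v; rewrite !comp_lfunE !adjE. Qed.

Lemma adj1 : adj \1%VF = \1%VF.
Proof. by apply: adjI => u v; rewrite !id_lfunE. Qed.

Lemma adjD T S : adj (T + S) = adj T + adj S.
Proof. by apply: adjI => u v; rewrite !add_lfunE dotDl dotDr !adjE. Qed.

Lemma adjN T : adj (- T) = - adj T.
Proof. by apply: adjI => u v; rewrite !opp_lfunE dotNl dotNr adjE. Qed.

Lemma adjB T S : adj (T - S) = adj T - adj S.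
Proof. by rewrite adjD adjN. Qed.

Lemma adjZ c T : adj (c *: T) = c^*%R *: adj T.
Proof. by apply: adjI => u v; rewrite !scale_lfunE dotZl dotZr conjCK adjE. Qed.

Lemma lfun_dotP T S : (forall u v, '[T u, v] = '[S u, v]) -> T = S.
Proof. by move=> e; apply/lfunP => u; apply: dot_injl => v. Qed.

(** Finite dimension enters here: a trivial kernel forces full rank, so the inverse on the range is
    two-sided. *)
Lemma invertibleP T : (forall u, T u = 0 -> u = 0) -> invertible T.
Proof.
move=> inj; have kT : lker T == 0%VS.
  rewrite -subv0; apply/subvP => u; rewrite memv_ker memv0 => /eqP/inj ->.
  exact: eqxx.
by exists (T^-1)%VF; rewrite lker0_compVf // lker0_compfV.
Qed.

Lemma invertible_inj T u : invertible T -> T u = 0 -> u = 0.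
Proof.
move=> [S [ST _]] Tu; have /lfunP/(_ u) := ST.
by rewrite comp_lfunE id_lfunE Tu linear0.
Qed.

Lemma invertible_comp T S : invertible T -> invertible S -> invertible (T \o S)%VF.
Proof.
move=> hT hS; apply: invertibleP => u; rewrite comp_lfunE.
by move=> /(invertible_inj hT) /(invertible_inj hS).
Qed.

Lemma invertible_limg T V : invertible T -> \dim (T @: V)%VS = \dim V.
Proof.
move=> hT; apply: limg_dim_eq; apply/eqP; rewrite -subv0; apply/subvP => u.
rewrite memv_cap memv_ker => /andP[_ /eqP /(invertible_inj hT) ->].
exact: mem0v.
Qed.

(** An isometry is injective, hence has a two-sided inverse in finite dimension, and this must be
    the left inverse [adj U]. *)
Lemma isometry_unitary U : (adj U \o U)%VF = \1%VF -> unitary dot U.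
Proof.
move=> UU; split => //; have [|S [SU US]] := @invertibleP U.
  by move=> u Uu; have /lfunP/(_ u) := UU; rewrite comp_lfunE id_lfunE Uu linear0.
have <- // : S = adj U.
by rewrite -[S]comp_lfun1l -UU -comp_lfunA US comp_lfun1r.
Qed.

Lemma unitary_adj U : unitary dot U -> unitary dot (adj U).
Proof. by move=> [UU UU']; split; rewrite adjK. Qed.

Lemma unitary_comp U T : unitary dot U -> unitary dot T -> unitary dot (U \o T)%VF.
Proof.
move=> [UU _] [TT _]; apply: isometry_unitary.
by rewrite adjM -comp_lfunA (comp_lfunA (adj U)) UU comp_lfun1l TT.
Qed.

Lemma unitary_invertible U : unitary dot U -> invertible U.
Proof. by move=> [h1 h2]; exists (adj U). Qed.

Lemma Ad_comp T S X : Ad dot S (Ad dot T X) = Ad dot (T \o S)%VF X.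
Proof. by rewrite /Ad adjM !comp_lfunA. Qed.

Lemma dot_Ad T X u v : '[Ad dot T X u, v] = '[X (T u), T v].
Proof. by rewrite /Ad !comp_lfunE adjEl. Qed.

Section Projections.
Variable P : 'End(H).
Hypothesis hP : projection dot P.

Lemma projE u v : '[P u, v] = '[u, P v].
Proof. by rewrite adjE hP.2. Qed.

Lemma proj_idem u : P (P u) = P u.
Proof. by rewrite -comp_lfunE hP.1. Qed.

Lemma proj_dot u : '[P u, u] = '[P u, P u].
Proof. by rewrite -[in RHS]projE proj_idem. Qed.

Lemma proj_pyth u : '[u, u] = '[P u, P u] + '[u - P u, u - P u].
Proof.
rewrite !dotBl !dotBr -!proj_dot -[in X in _ = _ + (_ - X - _)]projE.
ring.
Qed.

Lemma proj_le1 u : '[P u, u] <= '[u, u].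
Proof. by rewrite [leRHS]proj_pyth proj_dot lerDl dot_ge0. Qed.

Lemma projC : projection dot (\1%VF - P).
Proof.
split; last by rewrite adjB adj1 hP.2.
apply/lfunP => u; rewrite !(comp_lfunE, add_lfunE, opp_lfunE, id_lfunE).
by rewrite linearB /= proj_idem subrr subr0.
Qed.

End Projections.

End OperatorAlgebra.

(** * Completely positive maps: Schwarz inequality, contractivity and support *)

Section CompletelyPositive.
Variables (R : realType) (A : cstarAlgType R).
Variables (H : vectType R[i]) (dot : {dot H for Num.conj}).
Implicit Types (Phi : A -> 'End(H)) (P T : 'End(H)) (a : A) (u v : H).

Local Notation "''[' u , v ]" := (dot u%R v%R) : ring_scope.
Local Notation adj := (adj dot).

(** Positivity of the new map at vectors h_i is positivity of [Phi] at the vectors T h_i. *)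
Lemma cp_Ad T Phi : completely_positive dot Phi ->
  completely_positive dot (fun a => Ad dot T (Phi a)).
Proof.
move=> [lPhi pPhi]; split.
  move=> c a b; apply: (@lfun_dotP _ _ dot) => u v.
  by rewrite lPhi add_lfunE scale_lfunE dotDl dotZl !dot_Ad add_lfunE scale_lfunE dotDl dotZl.
move=> n X pX h; have := pPhi n X pX (fun i => T (h i)).
under eq_bigr do under eq_bigr do rewrite mxE.
by under [in X in _ -> X]eq_bigr do under eq_bigr do rewrite mxE dot_Ad.
Qed.

Section Fixed.
Variable Phi : A -> 'End(H).
Hypothesis cpPhi : completely_positive dot Phi.

Lemma cpD a b : Phi (a + b) = Phi a + Phi b.
Proof. by have := cpPhi.1 1 a b; rewrite !scale1r. Qed.

Lemma cpZ c a : Phi (c *: a) = c *: Phi a.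
Proof.
have p0 : Phi 0 = 0.
  by have := cpD 0 0; rewrite addr0 => /eqP; rewrite -subr_eq0 opprD addNKr oppr_eq0 => /eqP.
by have := cpPhi.1 c a 0; rewrite p0 !addr0.
Qed.

Lemma cpB a b : Phi (a - b) = Phi a - Phi b.
Proof. by rewrite cpD -scaleN1r cpZ scaleN1r. Qed.

Lemma cp_star_mul_ge0 b u : 0 <= '[Phi (star b * b) u, u].
Proof.
have pX : @positive_mx _ A 1 (\matrix_(i, j) (star b * b)).
  exists (\matrix_(i, j) b); apply/matrixP => i j.
  by rewrite !mxE big_ord1 !mxE.
have := cpPhi.2 1%N _ pX (fun=> u).
by rewrite !big_ord1 !mxE.
Qed.

(* Positivity of the matrix [[1, a], [a^*, a^* a]]. *)
Lemma cp_two_positive a u v :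
  0 <= '[Phi 1 u, u] + '[Phi a v, u] + ('[Phi (star a) u, v] + '[Phi (star a * a) v, v]).
Proof.
pose Y : 'M[A]_2 := \matrix_(i, j) (if i == 0 then if j == 0 then 1 else a else 0).
have := cpPhi.2 2%N (mxstar Y *m Y) (ex_intro _ Y erefl) (fun i => if i == 0 then u else v).
rewrite !(big_ord_recl, big_ord0, mxE) /= !addr0.
by rewrite star1 star0 !mul0r !mul1r !mulr1 !addr0.
Qed.

(** The cross terms in [cp_two_positive] have a real sum, since the whole form and its diagonal
    terms are real; comparing this at [v] and at ['i *: v] separates the two cross terms. *)
Lemma cp_star a : Phi (star a) = adj (Phi a).
Proof.
apply: (@lfun_dotP _ _ dot) => u v; rewrite adjEl [RHS]dotC.
have re w z : ('[Phi a z, w] + '[Phi (star a) w, z])^*%R = '[Phi a z, w] + '[Phi (star a) w, z].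
  have h := ger0_real (cp_two_positive a w z).
  have h1 := ger0_real (cp_star_mul_ge0 1 w); rewrite star1 mulr1 in h1.
  have h2 := ger0_real (cp_star_mul_ge0 a z).
  apply: conj_Creal; have := rpredB (rpredB h h1) h2.
  set s := (X in X \in Num.real -> _).
  by have -> : s = '[Phi a z, w] + '[Phi (star a) w, z] by rewrite /s; ring.
have := re u v; have := re u ('i%R *: v).
rewrite [Phi a (_ *: _)]linearZ /= dotZl dotZr !rmorphD !rmorphM /= conjCK conjCi.
move: '[_, _] '[_, _] => p q e1 e2.
have gen (x y x' y' i : R[i]) : i != 0 -> - i * y' + i * x' = i * y + - i * x ->
    y' + x' = y + x -> x = y'.
  move=> i0 h1 h2; have two0 : (2 : R[i]) * i != 0 by rewrite mulf_neq0 ?pnatr_eq0.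
  have h3 : i * (y' + x') - (- i * y' + i * x') = i * (y + x) - (i * y + - i * x).
    by rewrite h1 h2.
  apply: (mulfI two0).
  have -> : 2 * i * x = i * (y + x) - (i * y + - i * x) by ring.
  by rewrite -h3; ring.
exact: gen (neq0Ci _) e1 e2.
Qed.

(* The Cauchy-Schwarz inequality, followed by positivity of [|a|^2 - a^* a]. *)
Lemma cp_schwarz a u : (forall u, '[Phi 1 u, u] <= '[u, u]) ->
  '[Phi a u, Phi a u] <= (cnorm a ^+ 2)%:C * '[Phi 1 u, u].
Proof.
move=> le1.
have h : '[Phi a u, Phi a u] <= '[Phi (star a * a) u, u].
  (* With - Phi(a) u as first vector, both cross terms equal -|Phi(a) u|^2; by [le1] the leading
     term cancels at most one of them. *)
  have := cp_two_positive a (- Phi a u) u; have := le1 (- Phi a u).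
  rewrite cp_star adjEl; set w := '[Phi 1 _, _].
  rewrite !dotNl !dotNr opprK => l1 l2; rewrite -subr_ge0.
  apply: le_trans l2 _; rewrite -subr_ge0; move: l1; rewrite -subr_ge0.
  set s := (X in 0 <= X -> _) => s0; set t := (X in 0 <= X).
  by have -> : t = s by rewrite /s /t; ring.
apply: le_trans h _.
set t := cnorm a ^+ 2.
have t0 : 0 <= t by exact: sqr_ge0.
have main (e : R) : 0 < e -> '[Phi (star a * a) u, u] <= (t + e)%:C * '[Phi 1 u, u].
  move=> e0; have te0 : 0 < t + e by lra.
  (* The slack [e] makes the norm s t of s a^* a strictly less than 1, as the square root requires,
     and keeps [s] meaningful when t = 0. *)
  pose s := (t + e)^-1.
  have s0 : 0 < s by rewrite invr_gt0.
  have [||| y yE] := @cstar_sqrt _ A (s%:C *: (star a * a)) (s * t).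
  - rewrite starZ starM starK; congr (_ *: _); apply: conj_Creal.
    by rewrite complex_real.
  - by rewrite cnormZr; [rewrite cnorm_star_mul | exact: ltW].
  - by rewrite /s mulrC ltr_pdivrMr // mul1r; lra.
  have := cp_star_mul_ge0 y u; rewrite yE cpB cpZ add_lfunE opp_lfunE scale_lfunE.
  rewrite dotBl dotZl subr_ge0 /s fmorphV /= => le.
  by rewrite -ler_pdivrMl ?ltcR.
have r1 : '[Phi 1 u, u] \is Num.real.
  by have := ger0_real (cp_star_mul_ge0 1 u); rewrite star1 mulr1.
have p1 : 0 <= '[Phi 1 u, u].
  by have := cp_star_mul_ge0 1 u; rewrite star1 mulr1.
have r2 := ger0_real (cp_star_mul_ge0 a u).
move: main p1; rewrite -(RRe_real r1) -(RRe_real r2).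
set q := complex.Re _; set p := complex.Re _ => main; rewrite ler0c => p0.
rewrite -rmorphM /= lecR; apply/ler_addgt0Pl => e e0.
(* Dividing by p + 1 instead of p covers the case p = 0. *)
have p1 : 0 < p + 1 by rewrite ltr_wpDl.
have := main _ (divr_gt0 e0 p1); rewrite -rmorphM /= lecR => /le_trans; apply.
rewrite mulrDl addrC lerD2r -mulrA ger_pMr // mulrC ler_pdivrMr //; lra.
Qed.

(** Contractivity at 1 gives |Phi(1) u| <= |u|, which the expansion of |Phi(1) u - u|^2 >= 0 turns
    into the form inequality; the converse is [cp_schwarz]. *)
Lemma cp_contractive :
  contractive dot Phi <-> forall u, '[Phi 1 u, u] <= '[u, u].
Proof.
split=> [ctr u|le1 a u].
  have := ctr 1 u; rewrite cnorm1 mul1r => le.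
  have le2 : '[Phi 1 u, Phi 1 u] <= '[u, u].
    by rewrite !dot_hnorm lecR ler_pXn2r // nnegrE sqrtr_ge0.
  have s : '[u, Phi 1 u] = '[Phi 1 u, u].
    rewrite dotC conj_Creal // ger0_real //.
    by have := cp_star_mul_ge0 1 u; rewrite star1 mulr1.
  have := dot_ge0 dot (Phi 1 u - u); rewrite dotBl !dotBr s => le3.
  have /(le_trans le3) : '[Phi 1 u, Phi 1 u] - '[Phi 1 u, u] - ('[Phi 1 u, u] - '[u, u])
      <= ('[u, u] - '[Phi 1 u, u]) *+ 2.
    by rewrite mulr2n opprB lerD2r lerD2r.
  by rewrite pmulrn_lge0 // subr_ge0.
have c0 : 0 <= (cnorm a ^+ 2)%:C by rewrite ler0c sqr_ge0.
have := le_trans (cp_schwarz a u le1) (ler_wpM2l c0 (le1 u)).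
rewrite !dot_hnorm -rmorphM /= lecR -exprMn ler_pXn2r // nnegrE ?sqrtr_ge0 //.
by rewrite mulr_ge0 ?sqrtr_ge0 ?cnorm_ge0.
Qed.

(** By [cp_schwarz] at u - P u, every Phi(b) vanishes on the kernel of [P]; the second identity is
    the adjoint of the first at [star a]. *)
Lemma cp_supp P a : projection dot P -> Phi 1 = P ->
  (Phi a \o P)%VF = Phi a /\ (P \o Phi a)%VF = Phi a.
Proof.
move=> hP P1.
have r b : (Phi b \o P)%VF = Phi b.
  apply/lfunP => u; rewrite comp_lfunE; apply/eqP; rewrite eq_sym -subr_eq0 -linearB.
  apply/eqP/(@dot_eq0 _ _ dot)/eqP; rewrite eq_le dot_ge0 andbT.
  have Pu : P (u - P u) = 0 by rewrite linearB /= (proj_idem hP) subrr.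
  have := @cp_schwarz b (u - P u); rewrite P1 Pu dot0l mulr0.
  by apply=> v; exact: proj_le1.
by split; rewrite ?r // -[RHS](adjK dot) -cp_star -[Phi (star a)]r adjM cp_star adjK hP.2.
Qed.

End Fixed.
End CompletelyPositive.

(** * Rank-one operators, partial isometries and unitary equivalence of projections *)

Section PartialIsometries.
Variables (R : realType) (H : vectType R[i]) (dot : {dot H for Num.conj}).
Implicit Types (T P Q U V W : 'End(H)) (u v e f : H).

Local Notation "''[' u , v ]" := (dot u%R v%R) : ring_scope.
Local Notation adj := (adj dot).

Definition ketbra e f : 'End(H) := linfun (fun u => '[u, f] *: e).

Lemma ketbraE e f u : ketbra e f u = '[u, f] *: e.
Proof.
have lk : linear (fun u => '[u, f] *: e).
  by move=> c v w; rewrite dotDl dotZl scalerDl scalerA.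
pose k : {linear H -> H} := HB.pack (fun u => '[u, f] *: e) (GRing.isLinear.Build _ _ _ _ _ lk).
exact: (lfunE k).
Qed.

Lemma adj_ketbra e f : adj (ketbra e f) = ketbra f e.
Proof.
apply: adjI => u v; rewrite !ketbraE dotZl dotZr mulrC; congr (_ * _).
by rewrite -dotC.
Qed.

Lemma ketbraM e f e' f' :
  (ketbra e f \o ketbra e' f')%VF = '[e', f] *: ketbra e f'.
Proof.
by apply/lfunP => u; rewrite comp_lfunE scale_lfunE !ketbraE dotZl scalerA mulrC.
Qed.

Lemma comp_ketbra T e f : (T \o ketbra e f)%VF = ketbra (T e) f.
Proof. by apply/lfunP => u; rewrite comp_lfunE !ketbraE linearZ. Qed.

Lemma ketbra_comp T e f : (ketbra e f \o T)%VF = ketbra e (adj T f).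
Proof. by apply/lfunP => u; rewrite comp_lfunE !ketbraE adjE. Qed.

Lemma ketbra0l f : ketbra 0 f = 0.
Proof. by apply/lfunP => u; rewrite ketbraE scaler0 zero_lfunE. Qed.

Lemma ketbra0r e : ketbra e 0 = 0.
Proof. by apply/lfunP => u; rewrite ketbraE dot0r scale0r zero_lfunE. Qed.

Lemma unit_vector v : v != 0 -> exists c, '[c *: v, c *: v] = 1.
Proof.
move=> v0; exists (hnorm dot v)^-1%:C; rewrite dotZl dotZr dot_hnorm.
rewrite conj_Creal ?complex_real // -!rmorphM /= mulrA -expr2 -exprMn mulVf ?expr1n //.
apply: contra v0 => /eqP h; apply/eqP/(@dot_eq0 _ _ dot).
by rewrite dot_hnorm h expr0n.
Qed.

Lemma limg_projP P u : projection dot P -> reflect (P u = u) (u \in limg P).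
Proof.
move=> hP; apply: (iffP idP) => [/memv_imgP[v _ ->]|<-]; first exact: (proj_idem hP).
exact: memv_img (memvf u).
Qed.

Lemma proj_deflate P d : projection dot P -> \dim (limg P) = d.+1 ->
  exists e, [/\ P e = e, '[e, e] = 1, projection dot (P - ketbra e e)
    & \dim (limg (P - ketbra e e)) = d].
Proof.
move=> hP dP; have v0 : vpick (limg P) != 0 by rewrite vpick0 -dimv_eq0 dP.
have [c ce] := unit_vector v0; pose e := c *: vpick (limg P).
have Pe : P e = e.
  by apply/(limg_projP _ hP); rewrite memvZ // memv_pick.
have hP' : projection dot (P - ketbra e e).
  split; last by rewrite adjB adj_ketbra hP.2.
  rewrite !(comp_lfunDl, comp_lfunDr, comp_lfunNl, comp_lfunNr) ketbraM ce scale1r.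
  by rewrite comp_ketbra ketbra_comp hP.2 Pe hP.1 opprK addNr addr0.
exists e; split => //; have [hPP _] := hP.
have imE : limg (P - ketbra e e) = ((P - ketbra e e) @: limg P)%VS.
  rewrite -limg_comp comp_lfunDl comp_lfunNl ketbra_comp hP.2 Pe hPP.
  by [].
(* Rank-nullity on the range of [P]: there the kernel of P - |e><e| is the line of [e], which is the
   one dimension lost. *)
rewrite imE; apply: succn_inj; rewrite -dP -(limg_ker_dim (P - ketbra e e) (limg P)) -add1n.
congr (_ + _)%N; transitivity (\dim <[e]>%VS).
  rewrite dim_vline; suff -> : e != 0 by [].
  by apply/negP => /eqP e0; have /eqP := ce; rewrite -/e e0 dot0l eq_sym oner_eq0.
congr (\dim _); apply/vspaceP => u; rewrite memv_cap memv_ker add_lfunE opp_lfunE ketbraE.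
apply/vlineP/andP => [[k ->]|[/(limg_projP _ hP) -> uE]].
  split; first by rewrite memvZ //; apply/(limg_projP _ hP).
  by rewrite linearZ /= Pe dotZl ce mulr1 subrr.
by exists '[u, e]; apply/eqP; rewrite -subr_eq0.
Qed.

(** On the kernel of [P], |W v|^2 = <v, P v> = 0. *)
Lemma partial_isometryr W P : projection dot P -> (adj W \o W)%VF = P -> (W \o P)%VF = W.
Proof.
move=> hP WW; apply/lfunP => u; rewrite comp_lfunE; apply/eqP.
rewrite eq_sym -subr_eq0 -linearB; apply/eqP/(@dot_eq0 _ _ dot).
by rewrite adjE -comp_lfunE WW linearB /= (proj_idem hP) subrr dot0r.
Qed.

Lemma partial_isometryl W Q : projection dot Q -> (W \o adj W)%VF = Q -> (Q \o W)%VF = W.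
Proof.
move=> hQ WW; rewrite -[RHS](adjK dot) -(@partial_isometryr (adj W) Q) ?adjK //.
by rewrite adjM adjK hQ.2.
Qed.

(** Induction on the rank: remove unit vectors [e] and [f] from the two ranges and add |f><e| to the
    partial isometry [W] of the remainders. The cross terms vanish because W e = 0 and W^* f = 0. *)
Lemma proj_partial_isometry P Q : projection dot P -> projection dot Q ->
  \dim (limg P) = \dim (limg Q) ->
  exists W, (adj W \o W)%VF = P /\ (W \o adj W)%VF = Q.
Proof.
have [d] := ubnP (\dim (limg P)).
elim: d P Q => // d IH P Q; case dP: (\dim (limg P)) => [|m] dlt hP hQ dQ.
  have lim0 T : \dim (limg T) = 0%N -> T = 0.
    move=> /eqP; rewrite dimv_eq0 => /eqP T0; apply/lfunP => u.
    by apply/eqP; rewrite zero_lfunE -memv0 -T0 memv_img ?memvf.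
  by exists 0; rewrite (lim0 P) // (lim0 Q) // !(comp_lfun0l, comp_lfun0r).
have [e [Pe e1 hP' dP']] := proj_deflate hP dP.
have [f [Qf f1 hQ' dQ']] := proj_deflate hQ (esym dQ).
have [||W [WP WQ]] := IH _ (Q - ketbra f f) _ hP' hQ'.
- by rewrite dP'.
- by rewrite dP' dQ'.
have We : W e = 0.
  rewrite -(partial_isometryr hP' WP) comp_lfunE add_lfunE opp_lfunE ketbraE.
  by rewrite Pe e1 scale1r subrr linear0.
have Wf : adj W f = 0.
  rewrite -(partial_isometryl hQ' WQ) adjM comp_lfunE hQ'.2 add_lfunE opp_lfunE ketbraE.
  by rewrite Qf f1 scale1r subrr linear0.
exists (W + ketbra f e); rewrite adjD adj_ketbra.
rewrite !(comp_lfunDl, comp_lfunDr) !comp_ketbra !ketbra_comp !ketbraE ?adjK.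
by rewrite e1 f1 !scale1r We Wf WP WQ !(ketbra0l, ketbra0r) !addr0 !add0r !subrK.
Qed.

Lemma dim_limg_projC P : projection dot P ->
  (\dim (limg P) + \dim (limg (\1%VF - P)%R))%N = \dim (fullv : {vspace H}).
Proof.
move=> hP; rewrite -(limg_ker_dim P fullv) capfv addnC; congr (\dim _ + _)%N.
apply/vspaceP => u; rewrite memv_ker; have hC := projC hP.
apply/idP/eqP => [/(limg_projP _ hC)|Pu].
  rewrite add_lfunE opp_lfunE id_lfunE => /eqP.
  by rewrite -subr_eq0 addrAC subrr add0r oppr_eq0 => /eqP.
by apply/(limg_projP _ hC); rewrite add_lfunE opp_lfunE id_lfunE Pu subr0.
Qed.

(** The intertwiner [T] forces equal ranks, hence equal ranks of the complements; the sum of partial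
    isometries between the ranges and between the complements is the unitary. *)
Lemma unitary_conj_proj P Q T : projection dot P -> projection dot Q ->
  invertible T -> (Q \o T)%VF = (T \o P)%VF ->
  exists V, unitary dot V /\ (Q \o V)%VF = (V \o P)%VF.
Proof.
move=> hP hQ iT QT; have [hP' hQ'] := (projC hP, projC hQ).
(* [T] maps the range of [P] onto the range of T P = Q T, which is the range of [Q] since [T] is
   onto. *)
have dPQ : \dim (limg P) = \dim (limg Q).
  rewrite -(invertible_limg (limg P) iT) -limg_comp -QT limg_comp.
  congr (\dim (_ @: _)); apply/eqP.
  by rewrite eqEdim subvf /= invertible_limg.
have dPQ' : \dim (limg (\1%VF - P)%R) = \dim (limg (\1%VF - Q)%R).
  by apply/eqP; rewrite -(eqn_add2l (\dim (limg P))) dim_limg_projC // dPQ dim_limg_projC.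
have [W [WP WQ]] := proj_partial_isometry hP hQ dPQ.
have [W' [WP' WQ']] := proj_partial_isometry hP' hQ' dPQ'.
have rW := partial_isometryr hP WP; have lW := partial_isometryl hQ WQ.
have rW' := partial_isometryr hP' WP'; have lW' := partial_isometryl hQ' WQ'.
have QW' : (Q \o W' = 0)%VF.
  by rewrite -lW' comp_lfunA comp_lfunDr comp_lfun1r comp_lfunNr hQ.1 subrr comp_lfun0l.
have PW' : (W' \o P = 0)%VF.
  by rewrite -rW' -comp_lfunA comp_lfunDl comp_lfun1l comp_lfunNl hP.1 subrr comp_lfun0r.
have c1 : (adj W \o W' = 0)%VF.
  by rewrite -lW adjM hQ.2 -comp_lfunA QW' comp_lfun0r.
have c2 : (adj W' \o W = 0)%VF.
  rewrite -(adjK dot (_ \o _)%VF) adjM adjK c1; apply: adjI => u v.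
  by rewrite !zero_lfunE dot0l dot0r.
exists (W + W'); split.
  apply: isometry_unitary; rewrite adjD !(comp_lfunDl, comp_lfunDr) c1 c2 WP WP'.
  by rewrite addr0 add0r addrC subrK.
by rewrite comp_lfunDr comp_lfunDl QW' PW' rW lW.
Qed.

End PartialIsometries.

(** * Rank-one perturbations of the identity *)

Section RankOnePerturbation.
Variables (R : realType) (H : vectType R[i]) (dot : {dot H for Num.conj}).
Implicit Types (P S T : 'End(H)) (u v f g : H).

Local Notation "''[' u , v ]" := (dot u%R v%R) : ring_scope.
Local Notation adj := (adj dot).
Local Notation ketbra := (ketbra dot).

(** Complex polarization, with [v] and ['i *: v]. *)
Lemma quadratic_form0 T : (forall u, '[T u, u] = 0) -> T = 0.
Proof.
move=> T0; apply: (@lfun_dotP _ _ dot) => u v; rewrite zero_lfunE dot0l.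
have polar w : '[T u, w] + '[T w, u] = 0.
  by have := T0 (u + w); rewrite [T _]linearD /= dotDl !dotDr !T0 addr0 add0r.
have h1 := polar v; have := polar ('i%R *: v).
rewrite [T (_ *: _)]linearZ /= dotZl dotZr conjCi mulNr addrC => /eqP.
rewrite subr_eq0 => /eqP /(mulfI (neq0Ci _)) h2.
by move: h1; rewrite h2 => /eqP; rewrite -mulr2n mulrn_eq0 /= => /eqP.
Qed.

(** The root is sought as 1 + b |f><f|, which multiplies [f] by 1 + b t; requiring this factor to be
    s = sqrt(1 + c t) determines b = (s - 1) / t. *)
Lemma rank_one_sqrt f (c : R[i]) : f != 0 -> c \is Num.real -> 0 < 1 + c * '[f, f] ->
  exists S, invertible S /\ (adj S \o S)%VF = \1%VF + c *: ketbra f f.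
Proof.
move=> f0 cr; set t := '[f, f] => h.
have t0 : 0 < t by rewrite /t dnorm_gt0.
pose s := sqrtC (1 + c * t); have s0 : 0 < s by rewrite sqrtC_gt0.
pose b := (s - 1) / t.
have br : b \is Num.real.
  by rewrite rpred_div ?rpredB ?ger0_real ?ltW ?ltr01.
have bt : 1 + b * t = s by rewrite /b divfK ?gt_eqF // addrC subrK.
have bE : b + b + b * (b * t) = c.
  have -> : b + b + b * (b * t) = (s ^+ 2 - 1) / t.
    by rewrite /b; field; rewrite gt_eqF.
  by rewrite sqrtCK addrAC subrr add0r mulfK ?gt_eqF.
exists (\1%VF + b *: ketbra f f); split.
  apply: invertibleP => u; rewrite add_lfunE scale_lfunE id_lfunE ketbraE => Su.
  have : s * '[u, f] = 0.
    have : '[u + b *: ('[u, f] *: f), f] = 0 by rewrite Su dot0l.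
    by rewrite dotDl !dotZl -/t => <-; rewrite -[in LHS]bt; ring.
  move/eqP; rewrite mulf_eq0 gt_eqF //= => /eqP uf.
  by move: Su; rewrite uf scale0r scaler0 addr0.
rewrite adjD adj1 adjZ adj_ketbra conj_Creal //.
rewrite !(comp_lfunDl, comp_lfunDr) !(comp_lfun1l, comp_lfun1r) -addrA; congr (_ + _).
rewrite -comp_lfunZl -comp_lfunZr ketbraM !scalerA -!scalerDl -/t; congr (_ *: _).
by rewrite -bE addrA mulrA.
Qed.

(** This is Cauchy-Schwarz for the semidefinite form of 1 - P at [u] and [g], whose values at (u, g)
    and (g, g) are <u, f> and <f, g>. The scalar [c] minimizes the form at u - c g. *)
Lemma semidefinite_ket_le P g u : adj P = P -> (forall u, '[P u, u] <= '[u, u]) ->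
  let f := g - P g in 0 < '[f, g] -> `|'[u, f]| ^+ 2 / '[f, g] <= '[u, u] - '[P u, u].
Proof.
move=> sP le1 f; set s := '[f, g] => s0.
have PE v w : '[P v, w] = '[v, P w] by rewrite adjE sP.
have fE v : '[v, f] = '[v, g] - '[P v, g] by rewrite dotBr PE.
have fC v : '[f, v] = '[g, v] - '[P g, v] by rewrite dotBl.
pose c := '[u, f] / s.
have := le1 (u - c *: g); rewrite -subr_ge0.
have cE : c^*%R * s = '[f, u].
  rewrite /c rmorphM /= -dotC fmorphV /= (conj_Creal (ger0_real (ltW s0))) divfK //.
  by rewrite gt_eqF.
suff -> : '[u - c *: g, u - c *: g] - '[P (u - c *: g), u - c *: g]
   = '[u, u] - '[P u, u] - `|'[u, f]| ^+ 2 / s by rewrite subr_ge0.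
rewrite normCK -[X in _ * X / _]dotC.
have -> : '[u, f] * '[f, u] / s = c * '[f, u] by rewrite /c mulrAC.
rewrite [P (_ - _)]linearB /= [P (_ *: _)]linearZ /= !dotBl !dotBr !dotZl !dotZr.
have e1 : c^*%R * '[u, g] - c^*%R * '[P u, g] = c^*%R * '[u, f] by rewrite fE mulrBr.
have e2 : c * '[f, u] = c * '[g, u] - c * '[P g, u] by rewrite fC mulrBr.
have e3 : '[g, g] - '[P g, g] = s by rewrite /s fC.
have e4 : c^*%R * '[u, f] = c * '[f, u].
  have xE : '[u, f] = c * s by rewrite /c divfK ?gt_eqF.
  by rewrite -cE xE mulrCA.
transitivity ('[u, u] - '[P u, u] - (c^*%R * '[u, g] - c^*%R * '[P u, g])
   - (c * '[g, u] - c * '[P g, u]) + c * (c^*%R * ('[g, g] - '[P g, g]))).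
  by ring.
by rewrite e1 e4 -e2 e3 cE subrK e2 mulrBr.
Qed.

End RankOnePerturbation.

(** * The value at 1 of a C*-extreme contractive map *)

Section ExtremePoints.
Variables (R : realType) (A : cstarAlgType R).
Variables (H : vectType R[i]) (dot : {dot H for Num.conj}).
Implicit Types (Phi Psi : A -> 'End(H)) (P T S U V : 'End(H)) (a : A) (u v : H).

Local Notation "''[' u , v ]" := (dot u%R v%R) : ring_scope.
Local Notation adj := (adj dot).
Local Notation ketbra := (ketbra dot).

Lemma cp_contractive_sqr Phi u : completely_positive dot Phi -> contractive dot Phi ->
  '[Phi 1 u, Phi 1 u] <= '[Phi 1 u, u].
Proof.
move=> cp /(cp_contractive cp) le1.
by have := cp_schwarz cp 1 u le1; rewrite cnorm1 expr1n mul1r.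
Qed.

(** Since Phi(a) = P Phi(a) P, the operator Ad_T(Phi(a)) depends only on P T. *)
Lemma cp_Ad_eq Phi P T S a : completely_positive dot Phi -> projection dot P ->
  Phi 1 = P -> (P \o T)%VF = (P \o S)%VF -> Ad dot T (Phi a) = Ad dot S (Phi a).
Proof.
move=> cp hP P1 TS; have [rP lP] := cp_supp cp a hP P1.
have key X : Ad dot X (Phi a) = (adj (P \o X) \o Phi a \o (P \o X))%VF.
  by rewrite adjM hP.2 !comp_lfunA -(comp_lfunA _ P (Phi a)) lP -(comp_lfunA _ (Phi a) P) rP.
by rewrite !key TS.
Qed.

Lemma CP_at_CCP Phi P : projection dot P -> CP_at A dot P Phi -> CCP A dot Phi.
Proof.
move=> hP [cp P1]; split => //; apply/(cp_contractive cp) => u.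
by rewrite P1; exact: proj_le1.
Qed.

Lemma adj_cp1 Phi : completely_positive dot Phi -> adj (Phi 1) = Phi 1.
Proof. by move=> cp; rewrite -cp_star // star1. Qed.

Lemma CCP_Ad Phi T : completely_positive dot Phi ->
  (forall u, '[Phi 1 (T u), T u] <= '[u, u]) -> CCP A dot (fun a => Ad dot T (Phi a)).
Proof.
move=> cp le; have cpT := cp_Ad T cp; split => //.
by apply/(cp_contractive cpT) => u; rewrite dot_Ad.
Qed.

Lemma extreme_CCP_projection Phi : cstar_extreme_CCP A dot Phi -> projection dot (Phi 1).
Proof.
move=> [[cp ctr] ext]; set P := Phi 1.
have sP : adj P = P by exact: adj_cp1.
have PE v w : '[P v, w] = '[v, P w] by rewrite adjE sP.
have le1 : forall u, '[P u, u] <= '[u, u] by exact/(cp_contractive cp).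
split=> //; apply: contrapT => nP.
have [g g0] : exists g, '[(P - (P \o P)%VF) g, g] != 0.
  apply: contrapT => ng; apply: nP; apply/esym/eqP; rewrite -subr_eq0; apply/eqP.
  apply: (@quadratic_form0 _ _ dot) => u; apply/eqP/negPn/negP => h.
  by apply: ng; exists u.
pose f := g - P g; pose s := '[f, g]; pose t := '[f, f].
have stE : s - t = '[(P - (P \o P)%VF) g, g].
  rewrite /s /t /f add_lfunE opp_lfunE comp_lfunE !dotBl !dotBr !PE; ring.
have st : t < s.
  rewrite -subr_gt0 stE lt_def g0 add_lfunE opp_lfunE comp_lfunE dotBl (PE (P g)).
  by rewrite subr_ge0; exact: cp_contractive_sqr.
have t0 : 0 <= t by exact: dot_ge0.
have s0 : 0 < s by exact: le_lt_trans t0 st.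
have f0 : f != 0.
  by apply/negP => /eqP f0; move: s0; rewrite /s f0 dot0l ltxx.
have tn0 : 0 < t by rewrite /t dnorm_gt0.
have sr : s^-1 \is Num.real by rewrite rpredV ger0_real // ltW.
have [||S1 [iS1 S1E]] := @rank_one_sqrt _ _ dot f (- s^-1) f0.
- by rewrite rpredN.
- by rewrite mulNr subr_gt0 -/t mulrC ltr_pdivrMr // mul1r.
have [|S2 [iS2 S2E]] := @rank_one_sqrt _ _ dot f s^-1 f0 sr.
  by rewrite addr_gt0 ?ltr01 // mulr_gt0 // invr_gt0.
have ket_ge0 u : 0 <= s^-1 * '[ketbra f f u, u].
  rewrite ketbraE dotZl [X in _ * (_ * X)]dotC -normCK mulr_ge0 ?exprn_ge0 //.
  by rewrite invr_ge0 ltW.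
(* Equality holds at u = g, so 1 / s is the largest admissible weight; this is what places [g] in
   [K] below. *)
have ket_le u : s^-1 * '[ketbra f f u, u] <= '[u, u] - '[P u, u].
  have := semidefinite_ket_le u sP le1 s0.
  by rewrite ketbraE dotZl [X in _ * (_ * X)]dotC -normCK mulrC.
have [S1' [S1K S1K']] := iS1; have [S2' [S2K S2K']] := iS2.
have inv S S' u : (S \o S' = \1)%VF -> '[u, u] = '[(adj S \o S)%VF (S' u), S' u].
  by move=> SS'; rewrite comp_lfunE adjEl -!comp_lfunE SS' id_lfunE.
pose k : R[i] := sqrtC 2^-1.
have kk : k^*%R * k = 2^-1.
  rewrite /k conj_Creal; first by rewrite -expr2 sqrtCK.
  by rewrite ger0_real // sqrtC_ge0 invr_ge0 ler0n.
have k0 : k != 0 by rewrite sqrtC_eq0 invr_eq0 pnatr_eq0.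
have half (X : 'End(H)) : 2^-1 *: X + 2^-1 *: X = X.
  have h : 1 = 2^-1 + 2^-1 :> R[i] by rewrite [LHS]splitr mul1r.
  by rewrite -scalerDl -h scale1r.
pose S (j : 'I_2) := if j == 0 then S1 else S2.
pose S' (j : 'I_2) := if j == 0 then S1' else S2'.
have [||||U hU] := ext 2%N (fun j a => Ad dot (S' j) (Phi a)) (fun j => k *: S j) erefl.
(* Contractivity of the pieces means P <= S_j^* S_j: this is [ket_le] for [S1], and follows from P
   <= 1 <= S2^* S2 for [S2]. *)
- move=> j; apply: CCP_Ad => // u; rewrite -/P /S'; case: (j == 0).
    rewrite (inv _ _ u S1K') S1E add_lfunE scale_lfunE id_lfunE dotDl dotZl mulNr.
    by rewrite lerBrDr -lerBrDl ket_le.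
  rewrite (inv _ _ u S2K') S2E add_lfunE scale_lfunE id_lfunE dotDl dotZl.
  by rewrite (le_trans (le1 _)) // lerDl.
- move=> j; apply: invertibleP => u; rewrite scale_lfunE => /eqP.
  rewrite scaler_eq0 (negPf k0) /= /S => /eqP.
  by case: (j == 0); exact: invertible_inj.
- rewrite !big_ord_recl big_ord0 addr0 /S /= !adjZ.
  rewrite -!comp_lfunZl -!comp_lfunZr !scalerA kk S1E S2E -scalerDr.
  by rewrite addrACA scaleNr addNr addr0 scalerDr half.
- move=> a; rewrite !big_ord_recl big_ord0 addr0 /S /S' /= !Ad_comp.
  rewrite -!comp_lfunZr S1K S2K /Ad !adjZ adj1.
  rewrite -!comp_lfunZl -!comp_lfunZr !comp_lfun1l !comp_lfun1r scalerA kk.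
  by rewrite half.
have [[UU UU'] /(_ 1)] := hU 0; rewrite -/P /S' /= => S1P.
(* As B^* P B = P and B^* B = S1^* S1, conjugation by [B] turns 1 - P into S1^* S1 - P. *)
pose B := (U 0 \o S1)%VF.
have iB : invertible B by apply: invertible_comp => //; exists (adj (U 0)).
have BPB u : adj B (P (B u)) = P u.
  have /lfunP/(_ u) : Ad dot S1 (Ad dot S1' P) = Ad dot S1 (Ad dot (U 0) P) by rewrite S1P.
  by rewrite !Ad_comp S1K /Ad adj1 comp_lfun1l comp_lfun1r !comp_lfunE => ->.
have BB : (adj B \o B)%VF = (adj S1 \o S1)%VF.
  by rewrite adjM -comp_lfunA (comp_lfunA (adj (U 0))) UU comp_lfun1l.
have iB' : invertible (adj B).
  by have [B' [BK BK']] := iB; exists (adj B'); rewrite -!adjM BK BK' adj1.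
pose K0 := lker (\1%VF - P); pose K := lker ((adj S1 \o S1)%VF - P).
(* Vectors fixed by [P] are orthogonal to f = (1 - P) g, so [S1] leaves their form unperturbed. *)
have K0K : (K0 <= K)%VS.
  apply/subvP => u /eqlfunP; rewrite id_lfunE => uP; apply/eqlfunP.
  rewrite S1E add_lfunE scale_lfunE ketbraE id_lfunE dotBr -PE -uP subrr.
  by rewrite scale0r scaler0 addr0.
have BK : (B @: K <= K0)%VS.
  apply/subvP => _ /memv_imgP[u /eqlfunP Ku ->]; apply/eqlfunP; rewrite id_lfunE.
  apply/eqP; rewrite -subr_eq0; apply/eqP/(invertible_inj iB').
  by rewrite linearB /= BPB -comp_lfunE BB Ku subrr.
(* [B] embeds [K] into [K0], so the inclusion of [K0] in [K] is an equality by dimension. *)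
have KK0 : K0 = K.
  by apply/eqP; rewrite eqEdim K0K -(invertible_limg K iB) dimvS.
have gf : '[g, f] = s by rewrite dotC conj_Creal // ger0_real // ltW.
have : g \in K.
  apply/eqlfunP; rewrite S1E add_lfunE scale_lfunE ketbraE id_lfunE gf.
  by rewrite scaleNr scalerA mulVf ?gt_eqF // scale1r opprB addrC subrK.
rewrite -KK0 => /eqlfunP; rewrite id_lfunE => gP.
by move: f0; rewrite /f -gP subrr eqxx.
Qed.

End ExtremePoints.

(** * Comparison of the two notions of extreme point *)

Section Comparison.
Variables (R : realType) (A : cstarAlgType R).
Variables (H : vectType R[i]) (dot : {dot H for Num.conj}).
Implicit Types (Phi Psi : A -> 'End(H)) (P T S U V : 'End(H)) (a : A) (u v : H).

Local Notation "''[' u , v ]" := (dot u%R v%R) : ring_scope.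
Local Notation adj := (adj dot).

Lemma extreme_CCP_CP_at Phi P : projection dot P -> Phi 1 = P ->
  cstar_extreme_CCP A dot Phi -> cstar_extreme_CP_at A dot P Phi.
Proof.
move=> hP P1 [[cp ctr] ext]; split=> // n Phis T n0 hPhis iT sumT PhiE.
have [hC [PP sP]] := (projC hP, hP).
have PC : (P \o (\1%VF - P) = 0)%VF by rewrite comp_lfunDr comp_lfun1r comp_lfunNr PP subrr.
(* Evaluating the sum condition at [u] gives that the |P T_j u|^2 add up to <P u, u> = 0. *)
have kerT j u : P u = 0 -> P (T j u) = 0.
  move=> Pu; have : \sum_j '[P (T j u), P (T j u)] = 0.
    transitivity ('[P u, u]); last by rewrite Pu dot0l.
    rewrite -[in RHS]sumT sum_lfunE linear_sumlz; apply: eq_bigr => i _.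
    by rewrite !comp_lfunE -(proj_dot hP); exact/esym/adjEl.
  move=> /psumr_eq0P h; apply/(@dot_eq0 _ _ dot)/h => // i _; exact: dot_ge0.
have TP j : (P \o T j \o P)%VF = (P \o T j)%VF.
  apply/lfunP => u; rewrite !comp_lfunE; apply/eqP; rewrite -subr_eq0 -!linearB; apply/eqP.
  by apply: kerT; rewrite linearB /= (proj_idem hP) subrr.
have PT j : (P \o adj (T j) \o P)%VF = (adj (T j) \o P)%VF.
  by have := congr1 adj (TP j); rewrite !adjM sP comp_lfunA.
(* With c = n^(-1/2), the [n] contributions |c|^2 (1 - P) to the sum of the T'_j^* T'_j add up to 1
   - P. *)
pose c : R[i] := (sqrtC n%:R)^-1.
have n1 : (n%:R : R[i]) != 0 by rewrite pnatr_eq0 -lt0n.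
have c0 : c != 0 by rewrite invr_eq0 sqrtC_eq0.
have cc : c^*%R * c = n%:R^-1.
  rewrite conj_Creal; first by rewrite -expr2 exprVn sqrtCK.
  by rewrite ger0_real // invr_ge0 sqrtC_ge0 ler0n.
pose T' j := (P \o T j)%VF + c *: (\1%VF - P).
have PT' j : (P \o T' j)%VF = (P \o T j)%VF.
  by rewrite comp_lfunDr -comp_lfunZr PC scaler0 addr0 comp_lfunA PP.
have [||||U hU] := ext n Phis T' n0.
- by move=> j; exact: (CP_at_CCP hP).
- move=> j; apply: invertibleP => u T'u.
  have PTu : P (T j u) = 0 by rewrite -comp_lfunE -PT' comp_lfunE T'u linear0.
  have Pu : P u = u.
    move: T'u; rewrite add_lfunE comp_lfunE PTu add0r scale_lfunE => /eqP.
    rewrite scaler_eq0 (negPf c0) add_lfunE opp_lfunE id_lfunE subr_eq0.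
    by move=> /eqP <-.
  (* [T j] maps the kernel of [P] into itself, hence onto itself by dimension; so [u] lies in this
     kernel, while P u = u. *)
  have TK : (T j @: lker P)%VS = lker P.
    apply/eqP; rewrite eqEdim invertible_limg // leqnn andbT; apply/subvP.
    by move=> _ /memv_imgP[v + ->]; rewrite !memv_ker => /eqP /kerT ->.
  have : T j u \in lker P by rewrite memv_ker PTu.
  rewrite -TK => /memv_imgP[v + Tuv]; rewrite memv_ker => /eqP Pv.
  have uv : u = v.
    apply/eqP; rewrite -subr_eq0; apply/eqP/(invertible_inj (iT j)).
    by rewrite linearB /= Tuv subrr.
  by rewrite -Pu uv.
- have T'E j : (adj (T' j) \o T' j)%VF = (adj (T j) \o P \o T j)%VF + n%:R^-1 *: (\1%VF - P).
    rewrite {1}/T' adjD adjM adjZ hC.2 sP comp_lfunDl; congr (_ + _).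
      by rewrite -comp_lfunA PT' comp_lfunA.
    rewrite /T' comp_lfunDr comp_lfunA -comp_lfunZl comp_lfunDl comp_lfun1l comp_lfunNl PP.
    by rewrite subrr scaler0 comp_lfun0l add0r -comp_lfunZr -comp_lfunZl scalerA mulrC cc hC.1.
  rewrite (eq_bigr _ (fun j _ => T'E j)) big_split /= sumT sumr_const card_ord.
  by rewrite -scaler_nat scalerA divff // scale1r addrC subrK.
- move=> a; rewrite PhiE; apply: eq_bigr => j _; have [cpj Pj] := hPhis j.
  exact: (cp_Ad_eq a cpj hP Pj (esym (PT' j))).
by exists U => j; have [hj1 hj2] := hU j; split=> //; exact: unitary_invertible hj1.
Qed.

Lemma extreme_CP_at_CCP Phi P : projection dot P ->
  cstar_extreme_CP_at A dot P Phi -> cstar_extreme_CCP A dot Phi.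
Proof.
move=> hP [[cp P1] ext]; split; first by exact: (CP_at_CCP hP).
move=> n Phis T n0 hPhis iT sumT PhiE; have [PP sP] := hP.
have le1 j u : '[Phis j 1 u, u] <= '[u, u].
  by have [cpj ctrj] := hPhis j; have := (cp_contractive cpj).1 ctrj; apply.
have sqr_le j u : '[Phis j 1 u, Phis j 1 u] <= '[Phis j 1 u, u].
  by have [cpj ctrj] := hPhis j; exact: cp_contractive_sqr.
have sPj j : adj (Phis j 1) = Phis j 1 by have [cpj _] := hPhis j; exact: adj_cp1.
have sumP u : \sum_j '[Phis j 1 (T j u), T j u] = '[P u, u].
  rewrite -P1 PhiE sum_lfunE linear_sumlz; apply: eq_bigr => j _.
  exact/esym/dot_Ad.
have sum1 u : \sum_j '[T j u, T j u] = '[u, u].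
  rewrite -[X in _ = '[X, _]](id_lfunE u) -sumT sum_lfunE linear_sumlz; apply: eq_bigr => j _.
  by rewrite comp_lfunE; exact/esym/adjEl.
(* The nonnegative numbers <Phi_j(1) T_j u, T_j u> add up to <P u, u> = 0, and [sqr_le] passes from
   the form to the vector. *)
have on_ker j u : P u = 0 -> Phis j 1 (T j u) = 0.
  move=> Pu; have /psumr_eq0P h : \sum_j '[Phis j 1 (T j u), T j u] = 0.
    by rewrite sumP Pu dot0l.
  apply/(@dot_eq0 _ _ dot)/eqP; rewrite eq_le dot_ge0 andbT -(h _ j) //.
  by move=> i _; apply: le_trans (sqr_le i _); exact: dot_ge0.
(* Dually, the nonnegative defects of Phi_j(1) at T_j u add up to <u, u> - <P u, u> = 0. *)
have on_img j u : P u = u -> Phis j 1 (T j u) = T j u.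
  move=> Pu.
  have /psumr_eq0P h : \sum_j ('[T j u, T j u] - '[Phis j 1 (T j u), T j u]) = 0.
    by rewrite sumrB sumP sum1 Pu subrr.
  have {}h := h (fun i _ => etrans (subr_ge0 _ _) (le1 i _)) j isT.
  apply/eqP; rewrite eq_sym -subr_eq0; apply/eqP/(@dot_eq0 _ _ dot)/eqP.
  rewrite eq_le dot_ge0 andbT -h.
  set w := T j u; have wE : '[w, Phis j 1 w] = '[Phis j 1 w, w] by rewrite adjE sPj.
  by rewrite dotBl !dotBr wE lerBlDr lerDl subr_ge0.
have PjT j : (Phis j 1 \o T j)%VF = (T j \o P)%VF.
  apply/lfunP => u; rewrite !comp_lfunE -[RHS]on_img ?(proj_idem hP) //.
  apply/eqP; rewrite -subr_eq0 -!linearB; apply/eqP/on_ker.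
  by rewrite linearB /= (proj_idem hP) subrr.
(* Phi_j(1) is self-adjoint, and idempotent because it equals T_j P T_j^-1. *)
have hPj j : projection dot (Phis j 1).
  split=> //; have [T' [_ TT']] := iT j.
  rewrite -[RHS]comp_lfun1r -TT' comp_lfunA PjT -PP comp_lfunA -PjT -(comp_lfunA _ (T j) P) -PjT.
  by rewrite -!comp_lfunA TT' comp_lfun1r.
have [V hV] := choice (fun j => unitary_conj_proj hP (hPj j) (iT j) (PjT j)).
have [||||S hS] := ext n (fun j a => Ad dot (V j) (Phis j a)) (fun j => adj (V j) \o T j)%VF n0.
- move=> j; have [[VV _] PV] := hV j; split; first exact: cp_Ad (hPhis j).1.
  by rewrite /Ad -comp_lfunA PV comp_lfunA VV comp_lfun1l.
- move=> j; apply: invertible_comp => //.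
  exact/unitary_invertible/unitary_adj/(hV j).1.
(* Since V_j P V_j^* = Phi_j(1), the sum is that of the T_j^* Phi_j(1) T_j, which is Phi(1). *)
- rewrite -[RHS]P1 PhiE; apply: eq_bigr => j _; have [[_ VV] PV] := hV j.
  rewrite adjM adjK /Ad -!comp_lfunA (comp_lfunA P) (comp_lfunA (V j)) (comp_lfunA (V j) P).
  by rewrite -PV -(comp_lfunA _ (V j)) VV comp_lfun1r.
- move=> a; rewrite PhiE; apply: eq_bigr => j _; have [[_ VV] _] := hV j.
  by rewrite Ad_comp comp_lfunA VV comp_lfun1l.
exists (fun j => (P \o S j + (\1%VF - P)) \o adj (V j))%VF => j.
have [uV PV] := hV j; have [iS SE] := hS j; have [hC hC'] := projC hP.
pose U := (P \o S j)%VF + (\1%VF - P).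
(* Evaluation at 1 gives S_j^* P S_j = P, so P S_j is a partial isometry within the range of [P],
   and adding 1 - P completes it to a unitary. *)
have SPS : (adj (P \o S j) \o (P \o S j))%VF = P.
  have := SE 1; rewrite P1 /Ad -comp_lfunA PV comp_lfunA uV.1 comp_lfun1l => E.
  by rewrite [RHS]E adjM sP !comp_lfunA -(comp_lfunA _ P P) PP.
have CP := partial_isometryr hP SPS.
have Q0 : ((\1%VF - P) \o (P \o S j) = 0)%VF.
  by rewrite comp_lfunDl comp_lfun1l comp_lfunNl comp_lfunA PP subrr.
have Q0' : (adj (P \o S j) \o (\1%VF - P) = 0)%VF.
  by rewrite adjM sP -comp_lfunA comp_lfunDr comp_lfun1r comp_lfunNr PP subrr comp_lfun0r.
have uU : unitary dot U.
  apply: isometry_unitary; rewrite /U adjD hC' comp_lfunDl !(comp_lfunDr _ (P \o _)%VF).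
  by rewrite SPS Q0 Q0' hC addr0 add0r addrC subrK.
have PU : (P \o U)%VF = (P \o S j)%VF.
  by rewrite /U !comp_lfunDr comp_lfunA PP comp_lfun1r comp_lfunNr PP subrr addr0.
split; first by apply: unitary_comp uU _; exact: unitary_adj uV.
move=> a; rewrite -Ad_comp -/U (cp_Ad_eq a cp hP P1 PU) -SE Ad_comp uV.2.
by rewrite /Ad adj1 comp_lfun1l comp_lfun1r.
Qed.

End Comparison.

Theorem theorem4p12 (R : realType) (A : cstarAlgType R)
    (H : vectType R[i]) (dot : {dot H for Num.conj}) :
  cstar_extreme_CCP A dot =
  \bigcup_(P in [set P : 'End(H) | projection dot P]) cstar_extreme_CP_at A dot P.
Proof.
apply/seteqP; split=> [Phi ext|Phi [P hP ext]]; last exact: extreme_CP_at_CCP hP ext.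
have hP := extreme_CCP_projection ext.
by exists (Phi 1) => //; exact: extreme_CCP_CP_at ext.
Qed.
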